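(* Let $G$ be a finite group with central involution $z\in G$, let $X=\mathrm{Cay}(G,S)$ be a normal Cayley graph, and let $g\in G$. The vertices $g$ and $gz$ are strongly cospectral in $X$ if and only if for all $\chi,\psi\in\mathrm{Irr}(G)$, $\chi(S)/\chi(1)=\psi(S)/\psi(1)$ implies $\chi(z)/\chi(1)=\psi(z)/\psi(1)$.
   Context: $\mathrm{Irr}(G)$ is the set of irreducible complex characters of $G$, and $\chi(S)=\sum_{s\in S}\chi(s)$. $\mathrm{Cay}(G,S)$ is the graph with vertex set $G$ in which $g,h$ are adjacent iff $gh^{-1}\in S$. Normal Cayley graph (standing assumptions): $S\subseteq G\setminus\{1\}$ is a union of conjugacy classes of $G$, closed under inverses, generates $G$, and $S\ne G\setminus\{1\}$. Let $A$ be the adjacency matrix of $X$, with distinct eigenvalues $\theta_0,\dots,\theta_r$, and let $\tilde E_i$ be the orthogonal projection onto the $\theta_i$-eigenspace. Vertices $u,v$ are strongly cospectral if for every $i$ either $\tilde E_ie_u=\tilde E_ie_v$ or $\tilde E_ie_u=-\tilde E_ie_v$, where $e_u$ is the standard basis vector of $u$. *)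

(* Defs.v *)
From mathcomp Require Import all_boot all_order all_fingroup all_algebra.
From mathcomp Require Import all_solvable all_field all_character.

Set Implicit Arguments.
Unset Strict Implicit.
Unset Printing Implicit Defensive.

Import GRing.Theory Num.Theory.
Local Open Scope ring_scope.

(* A graph is given by a vertex set V in an ambient finite type T and an
   adjacency relation e; its matrices are indexed by 'I_#|V| through enum_val. *)
Section Graph.

Variables (T : finType) (V : {set T}) (e : rel T).

Definition adj_mx : 'M[algC]_#|V| :=
  \matrix_(i, j) (e (enum_val i) (enum_val j))%:R.

Definition vertex_vec (u : T) : 'rV[algC]_#|V| :=
  \row_j (enum_val j == u)%:R.

(* MathComp's eigenspaces consist of row vectors and its projections act on
   the right; for an undirected graph adj_mx is symmetric, so these are the
   usual eigenspaces up to transposition. *)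
Definition eigen_proj (theta : algC) : 'M[algC]_#|V| :=
  proj_ortho (eigenspace adj_mx theta).

Definition strongly_cospectral (u v : T) : Prop :=
  forall theta : algC, eigenvalue adj_mx theta ->
    vertex_vec u *m eigen_proj theta = vertex_vec v *m eigen_proj theta \/
    vertex_vec u *m eigen_proj theta = - (vertex_vec v *m eigen_proj theta).

End Graph.

Section Cayley.

Variable gT : finGroupType.
Local Open Scope group_scope.

Definition Cay (S : {set gT}) : rel gT := [rel g h | g * h^-1 \in S].

Definition union_of_classes (G : {group gT}) (S : {set gT}) : Prop :=
  exists2 D : {set {set gT}}, D \subset classes G & S = cover D.

Definition normal_Cayley (G : {group gT}) (S : {set gT}) : Prop :=
  [/\ S \subset G^#, union_of_classes G S, S^-1 = S, <<S>> = G & S != G^#].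

Definition central_involution (G : {group gT}) (z : gT) : Prop :=
  z \in 'Z(G) /\ #[z] = 2%N.

End Cayley.

Definition char_sum (gT : finGroupType) (G : {group gT}) (chi : 'CF(G))
    (S : {set gT}) : algC :=
  \sum_(s in S) chi s.

(* Main.v *)
Require Import Defs.
From mathcomp Require Import all_boot all_order all_fingroup all_algebra.
From mathcomp Require Import all_solvable all_field all_character.
From mathcomp Require Import ring.

(** The matrices [E_i] with entries [chi_i(1)/|G| * chi_i(g h^-1)] are pairwise
    orthogonal Hermitian idempotents summing to the identity, and the adjacency
    matrix acts on [E_i] as the scalar [chi_i(S)/chi_i(1)].  Hence the projection
    onto the [theta]-eigenspace is the sum of the [E_i] having this scalar equal
    to [theta].  Since [z] is central, the rows of [E_i] at [g] and [g z] differ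
    by the factor [chi_i(z)/chi_i(1)], a sign; as the row of [E_i] at [g] is
    nonzero, the rows of the projection at [g] and [g z] agree up to sign exactly
    when these factors coincide for all [i] in the sum. *)

Set Implicit Arguments.
Unset Strict Implicit.
Unset Printing Implicit Defensive.

Import GRing.Theory Num.Theory.
Local Open Scope ring_scope.
Local Open Scope sesquilinear_scope.

(** The sum [P] of the selected [E i] is a Hermitian idempotent whose rows lie in the eigenspace
    [U], and [U *m P = U]. The projection therefore fixes [P] and kills [1 - P], whose rows are
    orthogonal to [U]. *)
Lemma proj_ortho_eigenspace (C : numClosedFieldType) (n : nat) (I : finType)
    (E : I -> 'M[C]_n) (l : I -> C) (theta : C) :
  (forall i j, E i *m E j = (i == j)%:R *: E i) ->
  (forall i, (E i)^t* = E i) -> \sum_i E i = 1%:M ->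
  proj_ortho (eigenspace (\sum_i l i *: E i) theta) =
    \sum_(i | l i == theta) E i.
Proof.
move=> EE Eherm E1; set A := \sum_i _; set P := \sum_(i | _) _.
have EA i : E i *m A = l i *: E i.
  rewrite mulmx_sumr (bigD1 i) //= big1 => [|j /negPf ji].
    by rewrite -scalemxAr EE eqxx scale1r addr0.
  by rewrite -scalemxAr EE eq_sym ji scale0r scaler0.
have AE i : A *m E i = l i *: E i.
  rewrite mulmx_suml (bigD1 i) //= big1 => [|j /negPf ji].
    by rewrite -scalemxAl EE eqxx scale1r addr0.
  by rewrite -scalemxAl EE ji scale0r scaler0.
have PP : P *m P = P.
  rewrite mulmx_suml; apply: eq_bigr => i li.
  rewrite mulmx_sumr (bigD1 i) //= big1 => [|j /andP[_ /negPf ji]].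
    by rewrite EE eqxx scale1r addr0.
  by rewrite EE eq_sym ji scale0r.
have Pherm : P^t* = P.
  rewrite /P (big_morph (fun M => M^t*) (id1 := 0) (op1 := +%R)).
  - by apply: eq_bigr => i _; apply: Eherm.
  - by move=> M N; rewrite linearD map_mxD.
  - by rewrite linear0 map_mx0.
have sPU : (P <= eigenspace A theta)%MS.
  apply/eigenspaceP; rewrite mulmx_suml scaler_sumr.
  by apply: eq_bigr => i /eqP <-; apply: EA.
have UP : eigenspace A theta *m P = eigenspace A theta.
  have UA := eigenspaceP (submx_refl (eigenspace A theta)).
  rewrite -[RHS]mulmx1 -E1 !mulmx_sumr [RHS](bigID (fun i => l i == theta)) /=.
  rewrite [X in _ = _ + X]big1 ?addr0 // => i li.
  (* Evaluating [U *m A *m E i] in two ways, with [U] the eigenspace, shows that [U *m E i] vanishes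
     when [l i] differs from [theta]. *)
  have /eqP : theta *: (eigenspace A theta *m E i) =
              l i *: (eigenspace A theta *m E i).
    by rewrite scalemxAl -UA -mulmxA AE scalemxAr.
  rewrite -subr_eq0 -scalerBl scaler_eq0 subr_eq0 eq_sym (negPf li) /=.
  by move/eqP.
rewrite -[LHS]mul1mx -[X in X *m _](subrK P) mulmxDl.
rewrite (proj_ortho_id sPU) proj_ortho_0 ?add0r //.
apply/orthomx1P; rewrite -{1}UP trmx_mul map_mxM Pherm mulmxA.
by rewrite mulmxBl mul1mx PP subrr mul0mx.
Qed.

(** The rows of [E i] satisfy the eigenvector equation, so a trivial eigenspace would force
    [E i = 0]. *)
Lemma eigenvalue_sum_proj (F : fieldType) (n : nat) (I : finType)
    (E : I -> 'M[F]_n) (l : I -> F) (i : I) :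
  (forall i j, E i *m E j = (i == j)%:R *: E i) -> E i != 0 ->
  eigenvalue (\sum_i l i *: E i) (l i).
Proof.
move=> EE; apply: contraNneq => U0; rewrite -submx0 -U0.
apply/eigenspaceP; rewrite mulmx_sumr (bigD1 i) //= big1 => [|j /negPf ji].
  by rewrite -scalemxAr EE eqxx scale1r addr0.
by rewrite -scalemxAr EE eq_sym ji scale0r scaler0.
Qed.

Section CharacterProjections.

Variables (gT : finGroupType) (G : {group gT}).
Implicit Types (f h : gT -> algC) (i j : Iirr G) (x y z : gT).

(** By linearity in [phi] this reduces to irreducible [phi], where it is the generalized
    orthogonality relation; only the conjugate of ['chi_i] contributes. *)
Lemma sum_cfun_irrM (phi : 'CF(G)) i y :
  \sum_(x in G) phi x * 'chi_i (x * y)%g =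
    (\sum_(x in G) phi x * 'chi_i x) * ('chi_i y / 'chi_i 1%g).
Proof.
have nzG : (#|G|%:R : algC) != 0 by apply: neq0CG.
have irrM k w : \sum_(x in G) 'chi_k x * 'chi_i (x * w)%g =
    #|G|%:R * ((i == conjC_Iirr k)%:R * ('chi_i w / 'chi_i 1%g)).
  rewrite -generalized_orthogonality_relation mulVKf //.
  by apply: eq_bigr => x _; rewrite conjC_IirrE cfunE /= irr_inv conjCK mulrC.
have [a ->] := cfun_irr_sum phi.
have expand w : \sum_(x in G) (\sum_k a k *: 'chi_k) x * 'chi_i (x * w)%g =
    \sum_k a k * \sum_(x in G) 'chi_k x * 'chi_i (x * w)%g.
  under eq_bigr => x _ do rewrite sum_cfunE mulr_suml.
  rewrite exchange_big; apply: eq_bigr => k _; rewrite mulr_sumr.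
  by apply: eq_bigr => x _; rewrite cfunE mulrA.
(* With [x] written as [x * 1], the sum on the right becomes the case [y = 1] of the sum on the
   left. *)
under [in RHS]eq_bigr => x _ do rewrite -[x in 'chi_i x]mulg1.
rewrite !expand mulr_suml; apply: eq_bigr => k _.
by rewrite !irrM divff ?irr1_neq0 // mulr1 !mulrA.
Qed.

(** The indicator of a conjugation-stable set is a class function, so the previous identity applies
    to it. *)
Lemma sum_irrM (A : {set gT}) i y : (A <| G)%g ->
  \sum_(x in A) 'chi_i (x * y)%g =
    char_sum 'chi_i A * ('chi_i y / 'chi_i 1%g).
Proof.
move=> nAG; have sAG := normal_sub nAG.
have to_indicator f : \sum_(x in A) f x = \sum_(x in G) ('1_A : 'CF(G)) x * f x.
  rewrite [RHS](big_setID A) /= (setIidPr sAG) [X in _ = _ + X]big1 ?addr0.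
    by apply: eq_bigr => x Ax; rewrite cfuniE // Ax mul1r.
  by move=> x /setDP[_ /negPf nAx]; rewrite cfuniE // nAx mul0r.
by rewrite /char_sum !to_indicator sum_cfun_irrM.
Qed.

(** A central element is a conjugacy class by itself, so [sum_irrM] applies to [[set z]]; for [y]
    outside [G] both sides vanish. *)
Lemma irr_centerM z y i : z \in 'Z(G)%g ->
  'chi_i (y * z)%g = 'chi_i z / 'chi_i 1%g * 'chi_i y.
Proof.
case/centerP=> Gz cGz.
have nzG : ([set z] <| G)%g.
  rewrite /normal sub1set Gz; apply/subsetP => x Gx; rewrite inE.
  by rewrite conjg_set1 conjgE (cGz x Gx) mulKg.
have [Gy | nGy] := boolP (y \in G); last first.
  by rewrite !(@cfun0 _ _ _ y) ?(@cfun0 _ _ _ (y * z)%g) ?groupMr ?mulr0.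
have := sum_irrM i y nzG; rewrite /char_sum !big_set1 (cGz y Gy) => ->.
by rewrite mulrA mulrAC.
Qed.

(** Taking [y = z] in [irr_centerM], with [z * z = 1], shows that the ratio squares to 1. *)
Lemma irr_involution_sign z i : central_involution G z ->
  'chi_i z / 'chi_i 1%g = 1 \/ 'chi_i z / 'chi_i 1%g = -1.
Proof.
case=> Zz z2; have zz : (z * z = 1)%g by rewrite -expg2 -z2 expg_order.
have /eqP : ('chi_i z / 'chi_i 1%g) ^+ 2 = 1.
  have := irr_centerM z i Zz; rewrite zz expr2 => z1.
  by rewrite {2}(mulrC ('chi_i z)) mulrCA -z1 mulVf ?irr1_neq0.
by rewrite sqrf_eq1 => /orP[]/eqP ->; [left | right].
Qed.

(** The action of the group algebra element with coefficients [f] on the regular module; the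
    indicator of [S] gives the adjacency matrix of [Cay S]. *)
Definition group_mx f : 'M[algC]_#|G| :=
  \matrix_(a, b) f (enum_val a * (enum_val b)^-1)%g.

Lemma group_mxM f h :
  group_mx f *m group_mx h =
    group_mx (fun y => \sum_(x in G) f x^-1%g * h (x * y)%g).
Proof.
apply/matrixP=> a b; rewrite !mxE.
under eq_bigr do rewrite !mxE.
rewrite -(big_enum_val (fun k => f (enum_val a * k^-1)%g *
                                 h (k * (enum_val b)^-1)%g)).
(* Substituting [x * enum_val a] for the intermediate vertex turns the matrix product into a
   convolution. *)
rewrite (reindex_inj (mulIg (enum_val a))) /=.
apply: eq_big => x; first by rewrite groupMr ?enum_valP.
by rewrite invMg mulKVg mulgA.
Qed.

Lemma vertex_vec_group_mx f x a : x \in G ->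
  (vertex_vec G x *m group_mx f) 0 a = f (x * (enum_val a)^-1)%g.
Proof.
move=> Gx; rewrite mxE (bigD1 (enum_rank_in Gx x)) //= big1 => [|b nb].
  by rewrite !mxE enum_rankK_in // eqxx mul1r addr0.
rewrite !mxE [_ == x](_ : _ = false) ?mul0r //.
by apply: contraNF nb => /eqP bx; rewrite -{2}bx enum_valK_in.
Qed.

(** As [i] varies, these are the primitive central idempotents of the group algebra. *)
Definition irr_proj i := group_mx (fun x => 'chi_i 1%g / #|G|%:R * 'chi_i x).

Lemma irr_projM i j : irr_proj i *m irr_proj j = (i == j)%:R *: irr_proj i.
Proof.
rewrite group_mxM; apply/matrixP => a b; rewrite !mxE.
set y := (enum_val a * _)%g; have nzG : (#|G|%:R : algC) != 0 by apply: neq0CG.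
under eq_bigr => x _ do rewrite mulrACA [X in _ * X]mulrC.
have := generalized_orthogonality_relation y j i.
rewrite -mulr_sumr eq_sym => /(canRL (mulVKf nzG)) ->.
case: eqP => [->|_]; last by rewrite !mul0r !mulr0.
by field; rewrite nzG irr1_neq0.
Qed.

(** This is the decomposition of the regular character, which is [#|G|] at 1 and 0 elsewhere. *)
Lemma sum_irr_proj : \sum_i irr_proj i = 1%:M.
Proof.
apply/matrixP => a b; rewrite summxE !mxE.
under eq_bigr do rewrite mxE mulrAC.
rewrite -mulr_suml.
set y := (enum_val a * _)%g.
have := cfRegE G y; rewrite cfReg_sum sum_cfunE.
under eq_bigr do rewrite cfunE.
move=> ->; rewrite /y -eq_mulgV1 (inj_eq enum_val_inj).
by case: eqP => _; rewrite ?mul0r // mulfV ?neq0CG.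
Qed.

Lemma irr_proj_herm i : (irr_proj i)^t* = irr_proj i.
Proof.
apply/matrixP => a b; rewrite !mxE rmorphM /=.
rewrite -irr_inv invMg invgK; congr (_ * _).
by rewrite fmorph_div /= irr1_degree !conjC_nat.
Qed.

(** The diagonal entry is the square of ['chi_i 1] divided by [#|G|]. *)
Lemma irr_proj_row_neq0 i x : x \in G -> vertex_vec G x *m irr_proj i != 0.
Proof.
move=> Gx; apply/eqP => /matrixP/(_ 0 (enum_rank_in Gx x)); apply/eqP.
rewrite vertex_vec_group_mx // mxE enum_rankK_in // mulgV.
by rewrite !mulf_neq0 ?invr_eq0 ?neq0CG ?irr1_neq0.
Qed.

Lemma vertex_vec_irr_proj_centerM x z i : x \in G -> z \in 'Z(G)%g ->
  vertex_vec G (x * z)%g *m irr_proj i =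
    ('chi_i z / 'chi_i 1%g) *: (vertex_vec G x *m irr_proj i).
Proof.
move=> Gx Zz; have /centerP[Gz cGz] := Zz.
apply/rowP => a; rewrite [RHS]mxE !vertex_vec_group_mx ?groupM //.
rewrite -mulgA cGz ?groupV ?enum_valP // mulgA (irr_centerM _ _ Zz) //.
by rewrite mulrCA.
Qed.

Lemma normal_Cayley_normal S : normal_Cayley G S -> (S <| G)%g.
Proof.
case=> sSG [D sDG ->] _ _ _; apply/andP; split.
  by apply/bigcupsP => B /(subsetP sDG)/imsetP[x Gx ->]; rewrite class_subG.
apply/subsetP => x Gx; rewrite inE; apply/subsetP => _ /imsetP[y + ->].
case/bigcupP => B DB By; apply/bigcupP; exists B => //.
case/imsetP: (subsetP sDG _ DB) By => w _ ->.
by rewrite memJ_norm // (subsetP (class_norm w G)).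
Qed.

(** Inserting [sum_irr_proj] leaves one [i] at a time, where [sum_irrM] provides the scalar;
    [S^-1 = S] absorbs the inversion in [group_mxM]. *)
Lemma adj_mx_CayE S : normal_Cayley G S ->
  adj_mx G (Cay S) =
    \sum_i (char_sum 'chi_i S / 'chi_i 1%g) *: irr_proj i.
Proof.
move=> nCS; have nSG := normal_Cayley_normal nCS; case: nCS => _ _ SV _ _.
have sSG := normal_sub nSG.
have -> : adj_mx G (Cay S) = group_mx (fun x => (x \in S)%:R).
  by apply/matrixP => a b; rewrite !mxE.
rewrite -[LHS]mulmx1 -sum_irr_proj mulmx_sumr; apply: eq_bigr => i _.
rewrite group_mxM; apply/matrixP => a b; rewrite !mxE.
set y := (enum_val a * _)%g.
rewrite (big_setID S) /= (setIidPr sSG) [X in _ + X]big1 ?addr0; last first.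
  by move=> x /setDP[_ /negPf nSx]; rewrite -mem_invg SV nSx mul0r.
transitivity ('chi_i 1%g / #|G|%:R * \sum_(x in S) 'chi_i (x * y)%g).
  rewrite mulr_sumr; apply: eq_bigr => x Sx.
  by rewrite -mem_invg SV Sx mul1r.
by rewrite sum_irrM // mulrA [RHS]mulrCA !mulrA mulrAC.
Qed.

End CharacterProjections.

Theorem theorem2p4 (gT : finGroupType) (G : {group gT}) (z : gT)
    (S : {set gT}) (g : gT)
    (hz : central_involution G z) (hS : normal_Cayley G S) (hg : g \in G) :
  strongly_cospectral G (Cay S) g (g * z)%g <->
  (forall chi psi : 'CF(G), chi \in irr G -> psi \in irr G ->
     (char_sum chi S / chi 1%g = char_sum psi S / psi 1%g)%R ->
     (chi z / chi 1%g = psi z / psi 1%g)%R).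
Proof.
have [Zz _] := hz.
pose l (i : Iirr G) := char_sum 'chi_i S / 'chi_i 1%g.
pose w (i : Iirr G) := 'chi_i z / 'chi_i 1%g.
have projE theta : eigen_proj G (Cay S) theta =
    \sum_(i | l i == theta) irr_proj i.
  rewrite /eigen_proj adj_mx_CayE //.
  exact: proj_ortho_eigenspace (@irr_projM _ G) (@irr_proj_herm _ G)
                               (sum_irr_proj G).
have row_gz theta : vertex_vec G (g * z)%g *m eigen_proj G (Cay S) theta =
    \sum_(i | l i == theta) w i *: (vertex_vec G g *m irr_proj i).
  rewrite projE mulmx_sumr; apply: eq_bigr => i _.
  exact: vertex_vec_irr_proj_centerM.
have row_g theta : vertex_vec G g *m eigen_proj G (Cay S) theta =
    \sum_(i | l i == theta) vertex_vec G g *m irr_proj i.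
  by rewrite projE mulmx_sumr.
split=> [cosp _ _ /irrP[i ->] /irrP[j ->] lij | same theta _].
- have eig : eigenvalue (adj_mx G (Cay S)) (l i).
    rewrite adj_mx_CayE //; apply: (@eigenvalue_sum_proj _ _ _ _ l).
      exact: irr_projM.
    by apply: contraTneq (irr_proj_row_neq0 i hg) => ->; rewrite mulmx0 eqxx.
  have [e rowE] : exists e : algC, vertex_vec G (g * z)%g *m
      eigen_proj G (Cay S) (l i) =
      e *: (vertex_vec G g *m eigen_proj G (Cay S) (l i)).
    by case: (cosp _ eig) => ->; [exists 1 | exists (-1)];
      rewrite ?scale1r // scalerN scaleN1r opprK.
  (* Multiplying [rowE] by [irr_proj k] isolates the component at [k], which is nonzero, so the
     scalars [w k] and [e] can be compared. *)
  have we k : l k = l i -> w k = e.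
    move=> lk; have proj_k : eigen_proj G (Cay S) (l i) *m irr_proj k =
        irr_proj k.
      rewrite projE mulmx_suml (bigD1 k) /= ?lk //.
      rewrite irr_projM eqxx scale1r big1 ?addr0 // => m /andP[_ /negPf mk].
      by rewrite irr_projM mk scale0r.
    have /= /eqP := congr1 (mulmx^~ (irr_proj k)) rowE.
    rewrite -scalemxAl -!(mulmxA _ (eigen_proj G (Cay S) (l i))) proj_k
      vertex_vec_irr_proj_centerM //.
    rewrite -subr_eq0 -scalerBl scaler_eq0 (negPf (irr_proj_row_neq0 k hg)).
    by rewrite orbF subr_eq0 => /eqP.
  by rewrite -/(w i) -/(w j) !we.
rewrite row_gz row_g.
have [/= i /eqP li | none] := pickP (fun i => l i == theta); last first.
  by left; rewrite !big_pred0.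
(* By assumption [w] is constant on the indices with [l k = theta], so it factors out as a single
   sign. *)
have -> : \sum_(k | l k == theta) w k *: (vertex_vec G g *m irr_proj k) =
    w i *: \sum_(k | l k == theta) vertex_vec G g *m irr_proj k.
  rewrite scaler_sumr; apply: eq_bigr => k /eqP lk; congr (_ *: _).
  by apply: same; rewrite ?mem_irr // -/(l k) lk -li.
by case: (irr_involution_sign i hz) => wi; rewrite /w wi;
  [left; rewrite scale1r | right; rewrite scaleN1r opprK].
Qed.
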